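(* Let $k\in\mathbb{Z}_+$. If $N:=\mathrm{CAN}(2,k,2)$ is even, then a matrix in $\mathrm{CA}^*(2,k,2)$ is obtained by generating $k$ columns in $\{0,1\}^N$, one after another, following these three rules: 1. columns are generated without repetition; 2. the complement of an already generated column is not generated; 3. only columns with an equal number of zeros and ones are generated. That is, $k$ columns can be generated in this way and the resulting $N\times k$ matrix belongs to $\mathrm{CA}^*(2,k,2)$.
   Context: $\mathbb{Z}_+$ denotes the positive integers. $\mathrm{CA}(N;2,k,2)$ is the set of matrices in $\{0,1\}^{N\times k}$ such that for every two distinct columns each of the four pairs in $\{0,1\}^2$ appears in at least one row. $\mathrm{CAN}(2,k,2)$ is the minimum $N$ such that $\mathrm{CA}(N;2,k,2)\neq\emptyset$, and $\mathrm{CA}^*(2,k,2):=\mathrm{CA}(N;2,k,2)$ with $N=\mathrm{CAN}(2,k,2)$. The complement of a column $c\in\{0,1\}^N$ is $\mathbf{1}-c$, where $\mathbf{1}$ is the all-ones vector. It is a known fact in the literature (Rényi; Katona; Kleitman and Spencer) that $\mathrm{CAN}(2,k,2)$ is the smallest integer $N$ such that $k\leq\binom{N-1}{\lceil N/2\rceil}$. *)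

(* Defs.v *)
From mathcomp Require Import all_boot all_order all_algebra.

Set Implicit Arguments.
Unset Strict Implicit.
Unset Printing Implicit Defensive.

(* CA(N; 2, k, 2): strength 2, with the symbols 0 and 1 encoded as the booleans
   false and true. *)
Definition CA (N k : nat) : {set 'M[bool]_(N, k)} :=
  [set M : 'M[bool]_(N, k) |
    [forall j1 : 'I_k, forall j2 : 'I_k, (j1 != j2) ==>
      [forall a : bool, forall b : bool,
        exists i : 'I_N, (M i j1 == a) && (M i j2 == b)]]].

Lemma CA_nonempty (k : nat) : exists N : nat, CA N k != set0.
Proof.
exists #|{: {ffun 'I_k -> bool}}|; apply/set0Pn.
exists (\matrix_(i, j) (enum_val i : {ffun 'I_k -> bool}) j)%R.
rewrite inE; apply/forallP=> j1; apply/forallP=> j2; apply/implyP=> neq_j.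
apply/forallP=> a; apply/forallP=> b; apply/existsP.
exists (enum_rank [ffun j => if j == j1 then a else b]).
by rewrite !mxE enum_rankK !ffunE eqxx (eq_sym j2) (negPf neq_j) !eqxx.
Qed.

(* CAN(2, k, 2).  The minimum ranges over all natural numbers, so for k = 1,
   where the covering condition is vacuous, it is 0. *)
Definition CAN (k : nat) : nat := ex_minn (CA_nonempty k).

Definition CAstar (k : nat) : {set 'M[bool]_(CAN k, k)} := CA (CAN k) k.

Definition compl_col (N : nat) (c : 'cV[bool]_N) : 'cV[bool]_N :=
  map_mx negb c.

Definition balanced (N : nat) (c : 'cV[bool]_N) : bool :=
  #|[set i : 'I_N | c i ord0 == false]| == #|[set i : 'I_N | c i ord0 == true]|.

(* [generated s]: the columns of s can be produced one after another, in the
   order in which they occur in s, each new column being appended at the end. *)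
Inductive generated (N : nat) : seq 'cV[bool]_N -> Prop :=
| generated_nil : generated [::]
| generated_rcons (s : seq 'cV[bool]_N) (c : 'cV[bool]_N) :
    generated s ->
    c \notin s ->
    (forall d : 'cV[bool]_N, d \in s -> c != compl_col d) ->
    balanced c ->
    generated (rcons s c).

Definition mx_of_cols (N k : nat) (s : k.-tuple 'cV[bool]_N) :
    'M[bool]_(N, k) :=
  (\matrix_(i < N, j < k) tnth s j i ord0)%R.

(* Main.v *)
Require Import Defs.
From mathcomp Require Import all_boot all_order all_algebra.
From mathcomp Require Import zify.

Set Implicit Arguments.
Unset Strict Implicit.
Unset Printing Implicit Defensive.

(** The point is that rules 1-3 can never get stuck before [k] columns are
    produced, and that they force the covering property.

    For the covering property, let [c] and [d] be balanced columns and suppose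
    that the pair [(a, b)] appears in no row.  Then the rows where [c] is [a]
    are among the rows where [d] is [~~ b]; both sets have half of the rows, so
    they coincide, and then [c] is [d] or its complement
    ([balanced_pair_covered]).

    For the production of columns, view a column as the set of its [true]
    rows.  In a covering array with [k >= 2] columns, the [2k] sets given by the
    columns and their complements form an antichain: an inclusion between two of
    them says that some pair of symbols is missing
    from two columns, or some symbol from one.  Sperner's theorem gives
    [2k <= 'C(N, N./2)] ([CA_columns_le]), and for even [N] the right-hand side
    is the number of balanced columns.  Fewer than [k] columns and their
    complements thus cannot exhaust the balanced columns
    ([generated_extend]).

    Sperner's theorem comes from the Lubell-Yamamoto-Meshalkin inequality,
    multiplied by [n`!] so as to stay in the natural numbers. *)

(** * Sperner's theorem *)

Definition antichain (T : finType) (F : {set {set T}}) : Prop :=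
  {in F &, forall A B : {set T}, A \subset B -> A = B}.

(** This counts the maximal chains of subsets of [B] that meet [F]: exactly
    [#|A|`! * (#|B| - #|A|)`!] of them pass through [A], and none meets [F]
    twice.  The induction sorts the chains by the element [x] that is removed
    from [B] in their last step. *)
Lemma lubell_yamamoto_meshalkin (T : finType) (F : {set {set T}})
    (B : {set T}) :
  antichain F ->
  \sum_(A in F | A \subset B) #|A|`! * (#|B| - #|A|)`! <= #|B|`!.
Proof.
move=> acF; have [n] := ubnP #|B|; elim: n B => // n IHn B ltBn.
have [FB | nFB] := boolP (B \in F).
  rewrite (big_pred1 B) => [|A]; first by rewrite subnn fact0 muln1.
  (* Then [B] is the only member of [F] below [B]. *)
  apply/andP/eqP => [[FA /(acF _ _ FA FB)] // | -> //].
(* Otherwise all members of [F] below [B] are proper subsets, and one factor of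
   [(#|B| - #|A|)`!] is the number of choices of [x] in [B] outside [A]. *)
have sumB A : (A \in F) && (A \subset B) ->
    #|A|`! * (#|B| - #|A|)`! =
    \sum_(x in B | x \notin A) #|A|`! * (#|B :\ x| - #|A|)`!.
  case/andP=> FA sAB.
  have ltAB : #|A| < #|B|.
    apply: proper_card; rewrite properEneq sAB andbT.
    by apply: contraNneq nFB => <-.
  rewrite (eq_bigr (fun=> #|A|`! * (#|B| - #|A|).-1`!)) => [|x /andP[Bx _]].
    rewrite sum_nat_const.
    have -> : #|[pred x in B | x \notin A]| = #|B| - #|A|.
      rewrite -cardsDS //; apply: eq_card => x.
      by rewrite !inE andbC.
    case E: (#|B| - #|A|) => [|m]; first lia.
    by rewrite factS /= mulnCA.
  by rewrite (cardsD1 x B) Bx; congr (_ * _`!); lia.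
rewrite (eq_bigr _ sumB) (exchange_big_dep (fun x => x \in B)) /=; last first.
  by move=> A x _ /andP[].
have [B0 | [x0 Bx0]] := set_0Vmem B.
  by rewrite big_pred0 // => x; rewrite B0 inE.
apply: (@leq_trans (\sum_(x in B) #|B|.-1`!)); last first.
  rewrite sum_nat_const; case E: #|B| => [|m]; last by rewrite factS.
  by move: Bx0; rewrite (cards0_eq E) inE.
apply: leq_sum => x Bx.
have cardBx : #|B| = #|B :\ x|.+1 by rewrite (cardsD1 x) Bx.
rewrite cardBx /=; apply: leq_trans (IHn (B :\ x) _); last first.
  by move: ltBn; rewrite cardBx ltnS.
apply: eq_leq; apply: eq_bigl => A.
by rewrite subsetD1 Bx /= andbA.
Qed.

Lemma leq_fact_shift p q d : p <= q -> (p + d)`! * q`! <= p`! * (q + d)`!.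
Proof.
move=> le_pq; elim: d => [|d IHd]; first by rewrite !addn0.
rewrite !addnS !factS -mulnA [X in _ <= X]mulnCA.
by apply: leq_mul => //; lia.
Qed.

(** The middle binomial coefficient is the largest, with denominators cleared. *)
Lemma leq_fact_half n a :
  a <= n -> n./2`! * (n - n./2)`! <= a`! * (n - a)`!.
Proof.
move=> le_an; have [le_ah | lt_ha] := leqP a n./2.
  have := @leq_fact_shift a (n - n./2) (n./2 - a).
  have -> : a + (n./2 - a) = n./2 by lia.
  have -> : n - n./2 + (n./2 - a) = n - a by lia.
  by apply; lia.
have := @leq_fact_shift (n - a) n./2 (a - n./2).
have -> : n - a + (a - n./2) = n - n./2 by lia.
have -> : n./2 + (a - n./2) = a by lia.
rewrite mulnC [X in _ -> _ <= X]mulnC.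
by apply; lia.
Qed.

Theorem sperner (T : finType) (F : {set {set T}}) :
  antichain F -> #|F| <= 'C(#|T|, #|T|./2).
Proof.
move=> acF; set n := #|T|; set w := n./2`! * (n - n./2)`!.
have w_gt0 : 0 < w by rewrite muln_gt0 !fact_gt0.
rewrite -(leq_pmul2r w_gt0) bin_fact; last by rewrite /n; lia.
have := @lubell_yamamoto_meshalkin T F [set: T] acF; rewrite cardsT.
apply: leq_trans; rewrite -sum_nat_const.
rewrite [X in _ <= X](eq_bigl (mem F)) => [|A]; last by rewrite subsetT andbT.
by apply: leq_sum => A _; apply: leq_fact_half; apply: max_card.
Qed.

(** * The number of columns of a covering array *)

(** The complement of column [j] is the level set for the symbol [false], so
    that the pairs [(j, b)] index the columns together with their
    complements. *)
Definition level_set (N k : nat) (M : 'M[bool]_(N, k)) (jb : 'I_k * bool) :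
    {set 'I_N} :=
  [set i | M i jb.1 == jb.2].

Lemma CAP (N k : nat) (M : 'M[bool]_(N, k)) :
  reflect (forall j1 j2, j1 != j2 ->
             forall a b, exists i, M i j1 = a /\ M i j2 = b)
          (M \in CA N k).
Proof.
rewrite inE; apply: (iffP forallP) => [covM j1 j2 neq_j a b | covM j1].
  move/forallP/(_ j2)/implyP/(_ neq_j)/forallP/(_ a)/forallP/(_ b): (covM j1).
  by case/existsP=> i /andP[/eqP Ma /eqP Mb]; exists i.
apply/forallP=> j2; apply/implyP=> neq_j; apply/forallP=> a; apply/forallP=> b.
have [i [Ma Mb]] := covM _ _ neq_j a b.
by apply/existsP; exists i; rewrite Ma Mb !eqxx.
Qed.

(** With a second column available, each single symbol occurs in each column;
    this separates a column from its own complement. *)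
Lemma level_set_subset_inj (N k : nat) (M : 'M[bool]_(N, k)) :
  1 < k -> M \in CA N k ->
  forall x y, level_set M x \subset level_set M y -> x = y.
Proof.
move=> k_gt1 /CAP covM [j b] [j' b'] /subsetP sub.
have [eq_j | neq_j] := eqVneq j j'; last first.
  have [i [Mb Mb']] := covM _ _ neq_j b (~~ b').
  by have := sub i; rewrite !inE /= Mb Mb' eqxx => /(_ isT); case: (b').
have [j2 neq_j2] : exists j2, j != j2.
  have [j0 | ] := eqVneq (val j) 0; last first.
    by move=> nz; exists (Ordinal (ltnW k_gt1)).
  by exists (Ordinal k_gt1); rewrite -val_eqE /= j0.
have [i [Mb _]] := covM _ _ neq_j2 b true.
by have := sub i; rewrite -eq_j !inE /= Mb eqxx => /(_ isT)/eqP ->.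
Qed.

Lemma CA_columns_le (N k : nat) (M : 'M[bool]_(N, k)) :
  1 < k -> M \in CA N k -> k.*2 <= 'C(N, N./2).
Proof.
move=> k_gt1 CM; have inc := @level_set_subset_inj N k M k_gt1 CM.
have inj : injective (level_set M) by move=> x y eq_xy; apply: inc; rewrite eq_xy.
have acF : antichain (level_set M @: [set: 'I_k * bool]).
  by move=> _ _ /imsetP[x _ ->] /imsetP[y _ ->] /inc ->.
have := sperner acF.
by rewrite card_imset // cardsT card_prod !card_ord card_bool muln2.
Qed.

(** * Balanced columns *)

Definition col_level (N : nat) (c : 'cV[bool]_N) (b : bool) : {set 'I_N} :=
  [set i | c i ord0 == b].

Lemma balancedE (N : nat) (c : 'cV[bool]_N) :
  balanced c = (#|col_level c false| == #|col_level c true|).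
Proof. by []. Qed.

Lemma setC_col_level (N : nat) (c : 'cV[bool]_N) :
  ~: col_level c true = col_level c false.
Proof. by apply/setP=> i; rewrite !inE; case: (c i ord0). Qed.

Lemma card_col_level (N : nat) (c : 'cV[bool]_N) (b : bool) :
  balanced c -> #|col_level c b| = N./2.
Proof.
rewrite balancedE => /eqP bal; have := cardsC (col_level c true).
by rewrite setC_col_level card_ord; case: b; lia.
Qed.

Lemma compl_colK (N : nat) : involutive (@compl_col N).
Proof. by move=> c; apply/matrixP=> i j; rewrite !mxE negbK. Qed.

Lemma card_balanced (N : nat) :
  ~~ odd N -> #|[set c : 'cV[bool]_N | balanced c]| = 'C(N, N./2).
Proof.
move=> evN; pose support (c : 'cV[bool]_N) := col_level c true.
pose indicator (A : {set 'I_N}) : 'cV[bool]_N := (\col_i (i \in A))%R.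
have suppK : cancel support indicator.
  by move=> c; apply/matrixP=> i j; rewrite !mxE !inE eqb_id (ord1 j).
have indK : cancel indicator support.
  by move=> A; apply/setP=> i; rewrite !inE !mxE eqb_id.
rewrite -[in RHS](card_ord N) -card_draws -(card_imset _ (can_inj suppK)).
rewrite card_ord; apply: eq_card => A; rewrite -[A in LHS]indK.
rewrite mem_imset ?inE; last exact: can_inj suppK.
rewrite -[A in RHS]indK; set c := indicator A.
apply/idP/eqP => [/card_col_level -> // | cardc].
have := cardsC (support c).
by rewrite card_ord setC_col_level balancedE -/(support c) cardc; lia.
Qed.

Lemma balanced_pair_covered (N : nat) (c d : 'cV[bool]_N) (a b : bool) :
  balanced c -> balanced d -> c != d -> c != compl_col d ->
  exists i, c i ord0 = a /\ d i ord0 = b.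
Proof.
move=> balc bald neq_cd neq_ccd.
have [/existsP[i /andP[/eqP ca /eqP db]] | nex] :=
  boolP [exists i, (c i ord0 == a) && (d i ord0 == b)]; first by exists i.
have sub : col_level c a \subset col_level d (~~ b).
  apply/subsetP=> i; rewrite !inE => ca.
  move: nex; rewrite negb_exists => /forallP/(_ i); rewrite ca /=.
  by case: (d i ord0); case: (b).
have /eqP/setP eq_lev : col_level c a == col_level d (~~ b).
  by rewrite eqEcard sub (card_col_level _ balc) (card_col_level _ bald) leqnn.
have [eq_ab | neq_ab] := eqVneq a b.
  case/eqP: neq_ccd; apply/matrixP=> i j; rewrite mxE (ord1 j).
  move: (eq_lev i); rewrite !inE eq_ab.
  by case: (c i ord0); case: (d i ord0); case: (b).
case/eqP: neq_cd; apply/matrixP=> i j; rewrite (ord1 j).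
move: (eq_lev i) neq_ab; rewrite !inE.
by case: (c i ord0); case: (d i ord0); case: (a); case: (b).
Qed.

(** * The generation process *)

(** The rules compare a column only with earlier ones; since complementation is
    an involution, the resulting conditions are symmetric. *)
Lemma generated_inv (N : nat) (s : seq 'cV[bool]_N) :
  generated s ->
  [/\ uniq s, {in s, forall c, balanced c}
    & {in s &, forall c d, c != d -> c != compl_col d}].
Proof.
elim=> {s} [|s c _ [uniq_s bal_s ncompl_s] c_new c_ncompl bal_c].
  by split.
split=> [|d|d e]; rewrite ?rcons_uniq ?c_new //.
  by rewrite mem_rcons inE => /predU1P[-> // | /bal_s].
rewrite !mem_rcons !inE => /predU1P[-> | sd] /predU1P[-> | se].
- by rewrite eqxx.
- by move=> _; apply: c_ncompl.
- move=> _; apply: contraNneq (c_ncompl _ sd) => ->.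
  by rewrite compl_colK.
- exact: ncompl_s.
Qed.

Lemma generated_CA (N k : nat) (s : k.-tuple 'cV[bool]_N) :
  generated s -> mx_of_cols s \in CA N k.
Proof.
move=> /generated_inv[uniq_s bal_s ncompl_s]; apply/CAP=> j1 j2 neq_j a b.
have neq_s : tnth s j1 != tnth s j2.
  apply: contra neq_j => /eqP eq_s; apply/eqP/val_inj/eqP.
  rewrite -(nth_uniq (tnth s j1) _ _ uniq_s) ?size_tuple ?ltn_ord //.
  by rewrite -!tnth_nth eq_s.
have [| | | | i [ca db]] := @balanced_pair_covered _ (tnth s j1) (tnth s j2) a b.
- by apply: bal_s; apply: mem_tnth.
- by apply: bal_s; apply: mem_tnth.
- by [].
- by apply: ncompl_s => //; apply: mem_tnth.
by exists i; rewrite !mxE.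
Qed.

(** Rules 1 and 2 exclude at most two columns for each column of [s]: itself and
    its complement. *)
Lemma generated_extend (N : nat) (s : seq 'cV[bool]_N) :
  ~~ odd N -> generated s -> (size s).*2 < 'C(N, N./2) ->
  exists c, generated (rcons s c).
Proof.
move=> evN gen_s; rewrite -card_balanced // => lt_s.
pose excluded := s ++ map (@compl_col N) s.
have : ~~ ([set c | balanced c] \subset excluded).
  apply: contraL lt_s => /subset_leq_card le_exc; rewrite -leqNgt.
  apply: leq_trans le_exc (leq_trans (card_size _) _).
  by rewrite size_cat size_map addnn.
case/subsetPn=> c; rewrite inE mem_cat negb_or => balc /andP[nsc ncsc].
exists c; apply: generated_rcons => // d sd.
by apply: contraNneq ncsc => ->; apply: map_f.
Qed.

(** For [k = 1] the array has no rows, so that the only column is its own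
    complement and [2k <= 'C(N, N./2)] fails.  The form with [k.-1] is what the
    greedy choice requires, and for [k = 1] it is the positivity of the binomial
    coefficient. *)
Lemma CAN_columns_lt (k : nat) : (k.-1).*2 < 'C(CAN k, (CAN k)./2).
Proof.
have [k_gt1 | k_le1] := ltnP 1 k; last first.
  have -> : k.-1 = 0 by lia.
  by rewrite bin_gt0; lia.
rewrite /CAN; case: ex_minnP => N /set0Pn[M CM] _.
by apply: leq_trans (CA_columns_le k_gt1 CM); lia.
Qed.

Theorem corollary1 (k : nat) (k_gt0 : 0 < k) (N_even : ~~ odd (CAN k)) :
  (exists s : k.-tuple 'cV[bool]_(CAN k), generated s) /\
  (forall s : seq 'cV[bool]_(CAN k), generated s -> size s < k ->
     exists c : 'cV[bool]_(CAN k), generated (rcons s c)) /\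
  (forall s : k.-tuple 'cV[bool]_(CAN k), generated s ->
     mx_of_cols s \in CAstar k).
Proof.
have extend (s : seq 'cV[bool]_(CAN k)) : generated s -> size s < k ->
    exists c : 'cV[bool]_(CAN k), generated (rcons s c).
  move=> gen_s lt_sk; apply: generated_extend => //.
  by apply: leq_ltn_trans (CAN_columns_lt k); lia.
split; last by split=> [|s]; [exact: extend | exact: generated_CA].
have reach m : m <= k ->
    exists2 s : seq 'cV[bool]_(CAN k), generated s & size s = m.
  elim: m => [|m IHm] lt_mk; first by exists [::] => //; apply: generated_nil.
  have [s gen_s size_s] := IHm (ltnW lt_mk).
  have [|c gen_sc] := extend s gen_s; first by rewrite size_s.
  by exists (rcons s c); rewrite ?size_rcons ?size_s.
by have [s gen_s /eqP size_s] := reach k (leqnn k); exists (Tuple size_s).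
Qed.
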